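(* Let $R$ be a (commutative noetherian) normal domain and $C$ a finitely generated $R$-module. Then $[C]\in\mathfrak{S}_0^1(R)$ if and only if $C$ is a rank $1$ reflexive module and $\operatorname{Ext}_R^1(C,C)=0$. In particular, $\mathfrak{S}_0^1(R)\subseteq\operatorname{Cl}(R)$, that is, the rigid ideals of $R$ are reflexive.
   Context: All rings are commutative and noetherian. A finitely generated $R$-module $C$ is $n$-semidualizing ($n\in\mathbb{N}=\{0,1,2,\dots\}$) if $\operatorname{Hom}_R(C,C)\cong R$ and $\operatorname{Ext}_R^i(C,C)=0$ for all $0<i\leq n$. $\mathfrak{S}_0^n(R)$ denotes the set of isomorphism classes of $n$-semidualizing $R$-modules. An $R$-module $M$ is rigid if $\operatorname{Ext}_R^1(M,M)=0$; a rigid ideal is an ideal that is rigid as an $R$-module. For a normal domain $R$, put $(-)^*=\operatorname{Hom}_R(-,R)$; a finitely generated $R$-module $M$ is reflexive if $M\cong M^{**}$. The divisor class group $\operatorname{Cl}(R)$ is the set of isomorphism classes $[M]$ of reflexive $R$-modules $M$ of rank $1$, with additive identity $[R]$ and operations $[M]+[N]=[(M\otimes_R N)^{**}]$ and $[M]-[N]=[\operatorname{Hom}_R(N,M)]$. *)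

(* Defs.v *)
From HB Require Import structures.
From mathcomp Require Import all_boot all_order all_algebra.
From mathcomp Require Import all_classical.
From mathcomp Require freeg.

Set Implicit Arguments.
Unset Strict Implicit.
Unset Printing Implicit Defensive.

Import GRing.Theory.
Local Open Scope ring_scope.

Definition isomorphic (R : pzRingType) (M N : lmodType R) : Prop :=
  exists f : {linear M -> N}, bijective f.

Definition finitely_generated (R : pzRingType) (M : lmodType R) : Prop :=
  exists (n : nat) (e : 'I_n -> M),
    forall x : M, exists a : 'I_n -> R, x = \sum_(i < n) a i *: e i.

Section Submodule.
Context (R : pzRingType) (V : lmodType R) (S : submodClosed V).

Record submodule : Type := Submodule {
  submod_val : V;
  submod_valP : submod_val \in S
}.

HB.instance Definition _ := [isSub for submod_val].
HB.instance Definition _ := [Choice of submodule by <:].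
HB.instance Definition _ := GRing.SubChoice_isSubLmodule.Build R V
  (fun x => x \in S) submodule (GRing.subsemimodClosedP S).

Fact submod_val_is_linear : linear submod_val. Proof. by []. Qed.
HB.instance Definition _ :=
  GRing.isLinear.Build R submodule V _ submod_val submod_val_is_linear.

End Submodule.

(* An ideal of R is a submodule of the regular module R^o; unlike the library's
   proper ideals, R itself is allowed. *)
Definition ideal (R : comNzRingType) := submodClosed R^o.

Definition noetherian (R : comNzRingType) : Prop :=
  forall I : ideal R, finitely_generated (submodule I).

(* For a domain: integrally closed in its field of fractions. *)
Definition normal_domain (R : idomainType) : Prop :=
  forall z : {fraction R},
    integralOver (@FracField.tofrac R) z -> exists r : R, z = FracField.tofrac r.

(* Hom_R(M, N), a copy of {linear M -> N} carrying the pointwise R-module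
   structure. *)
Section Hom.
Context (R : comNzRingType) (M N : lmodType R).

Definition HomR : Type := {linear M -> N}.

HB.instance Definition _ := gen_eqMixin HomR.
HB.instance Definition _ := gen_choiceMixin HomR.

Lemma homR_ext (f g : HomR) :
  (f : {linear M -> N}) =1 (g : {linear M -> N}) -> f = g.
Proof.
case: f => f [[fA] [fZ]]; case: g => g [[gA] [gZ]] /= fg.
have E : f = g by apply/funext.
subst g.
by congr GRing.Linear.Pack; congr GRing.Linear.Class;
  [congr GRing.isNmodMorphism.Axioms_ | congr GRing.isScalable.Axioms_];
  exact: Prop_irrelevance.
Qed.

Let zero : HomR := (\0 : M -> N) : {linear M -> N}.
Let add (f g : HomR) : HomR :=
  ((f : {linear M -> N}) \+ (g : {linear M -> N})) : {linear M -> N}.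
Let scale (a : R) (f : HomR) : HomR :=
  (a \*: (f : {linear M -> N})) : {linear M -> N}.
Let opp (f : HomR) : HomR := (\- (f : {linear M -> N})) : {linear M -> N}.

Let addA : associative add.
Proof. by move=> f g h; apply: homR_ext => x /=; exact: addrA. Qed.
Let addC : commutative add.
Proof. by move=> f g; apply: homR_ext => x /=; exact: addrC. Qed.
Let add0 : left_id zero add.
Proof. by move=> f; apply: homR_ext => x /=; exact: add0r. Qed.
Let addN : left_inverse zero opp add.
Proof. by move=> f; apply: homR_ext => x /=; exact: addNr. Qed.

HB.instance Definition _ := GRing.isZmodule.Build HomR addA addC add0 addN.

Let scaleA a b f : scale a (scale b f) = scale (a * b) f.
Proof. by apply: homR_ext => x /=; exact: scalerA. Qed.
Let scale1 : left_id 1 scale.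
Proof. by move=> f; apply: homR_ext => x /=; exact: scale1r. Qed.
Let scaleDr : right_distributive scale +%R.
Proof. by move=> a f g; apply: homR_ext => x /=; exact: scalerDr. Qed.
Let scaleDl f : {morph scale^~ f : a b / a + b}.
Proof. by move=> a b; apply: homR_ext => x /=; exact: scalerDl. Qed.

HB.instance Definition _ := GRing.Zmodule_isLmodule.Build R HomR
  scaleA scale1 scaleDr scaleDl.

End Hom.

Definition dual (R : comNzRingType) (M : lmodType R) : lmodType R := HomR M R^o.

Definition reflexive_module (R : comNzRingType) (M : lmodType R) : Prop :=
  finitely_generated M /\ isomorphic M (dual (dual M)).

Section Rank.
Context (R : idomainType) (M : lmodType R).

Definition lin_indep (n : nat) (e : 'I_n -> M) : Prop :=
  forall a : 'I_n -> R, \sum_(i < n) a i *: e i = 0 -> forall i, a i = 0.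

(* The rank of a module over a domain: the maximal number of R-linearly
   independent elements, i.e. the dimension over the field of fractions. *)
Definition has_rank (n : nat) : Prop :=
  (exists e : 'I_n -> M, lin_indep e) /\
  (forall (m : nat) (e : 'I_m -> M), lin_indep e -> (m <= n)%N).

End Rank.

Section Ext.
Context (R : comNzRingType).

Definition projective (P : lmodType R) : Prop :=
  forall (A B : lmodType R) (g : {linear A -> B}) (f : {linear P -> B}),
    (forall b : B, exists a : A, g a = b) ->
    exists h : {linear P -> A}, forall x : P, g (h x) = f x.

Record proj_resolution (M : lmodType R) : Type := ProjResolution {
  pr_mod : nat -> lmodType R;
  pr_d : forall i : nat, {linear pr_mod i.+1 -> pr_mod i};
  pr_aug : {linear pr_mod 0%N -> M};
  pr_projective : forall i : nat, projective (pr_mod i);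
  pr_aug_surj : forall x : M, exists y : pr_mod 0%N, pr_aug y = x;
  pr_exact0 : forall y : pr_mod 0%N,
    pr_aug y = 0 <-> exists z : pr_mod 1%N, pr_d 0 z = y;
  pr_exactS : forall (i : nat) (y : pr_mod i.+1),
    pr_d i y = 0 <-> exists z : pr_mod i.+2, pr_d i.+1 z = y
}.

(* i-cocycles and i-coboundaries of the complex Hom_R(P, N). *)
Definition cocycle (M N : lmodType R) (P : proj_resolution M) (i : nat)
    (f : {linear pr_mod P i -> N}) : Prop :=
  forall y : pr_mod P i.+1, f (pr_d P i y) = 0.

Definition coboundary (M N : lmodType R) (P : proj_resolution M) (i : nat) :
    {linear pr_mod P i -> N} -> Prop :=
  match i with
  | 0%N => fun f => forall y, f y = 0
  | j.+1 => fun f => exists g : {linear pr_mod P j -> N},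
      forall y, f y = g (pr_d P j y)
  end.

(* Ext^i_R(M, N) = 0, i.e. H^i(Hom_R(P, N)) = 0 for every projective resolution
   P of M (resolutions exist, see [proj_resolution_exists]). *)
Definition Ext_eq0 (i : nat) (M N : lmodType R) : Prop :=
  forall (P : proj_resolution M) (f : {linear pr_mod P i -> N}),
    cocycle f -> coboundary f.

End Ext.

Definition rigid (R : comNzRingType) (M : lmodType R) : Prop := Ext_eq0 1 M M.

Definition semidualizing (R : comNzRingType) (n : nat) (C : lmodType R) : Prop :=
  [/\ finitely_generated C, isomorphic (HomR C C) R^o
    & forall i : nat, (0 < i <= n)%N -> Ext_eq0 i C C].

(* Isomorphism classes are predicates rather than [set (lmodType R)]: [lmodType]
   lives in a universe too large for the type argument of [set]. *)
Definition module_class (R : pzRingType) : Type := lmodType R -> Prop.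

Definition iso_class (R : pzRingType) (M : lmodType R) : module_class R :=
  fun N => isomorphic M N.

Definition semidualizing_classes (R : comNzRingType) (n : nat)
    (X : module_class R) : Prop :=
  exists2 C : lmodType R, semidualizing n C & X = iso_class C.

(* The underlying set of the divisor class group. *)
Definition Cl (R : idomainType) (X : module_class R) : Prop :=
  exists2 M : lmodType R, reflexive_module M /\ has_rank M 1 & X = iso_class M.

Module FreeResolution.
Import freeg.
Section FreeResolution.
Context (R : comNzRingType).

Section FreeModule.
Context (T : choiceType) (M : lmodType R).

Let fglift_additive (f : T -> M) : zmod_morphism (fglift f).
Proof. exact: lift_is_additive. Qed.

HB.instance Definition _ (f : T -> M) :=
  GRing.isZmodMorphism.Build {freeg T / R} M (fglift f) (fglift_additive f).

Let fglift_scalable (f : T -> M) : scalable (fglift f).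
Proof.
move=> c D; have -> : fglift f D = \sum_(x <- dom D) coeff x D *: f x.
  rewrite -[in LHS](freeg_sumE D) (raddf_sum (fglift f)).
  by apply: eq_bigr => x _; rewrite /= liftU.
rewrite [c *: D]/(fgscale c D) /fgscale (raddf_sum (fglift f)) scaler_sumr.
by apply: eq_bigr => x _; rewrite /= !liftU scalerA.
Qed.

HB.instance Definition _ (f : T -> M) :=
  GRing.isScalable.Build R {freeg T / R} M *:%R (fglift f) (fglift_scalable f).

Lemma freegUZ (c : R) (t : T) : << c *g t >> = c *: << 1 *g t >>.
Proof. by apply/eqP/freeg_eqP => x; rewrite coeffZ !coeffU mul1r. Qed.

End FreeModule.

Lemma freeg_projective (T : choiceType) : projective ({freeg T / R} : lmodType R).
Proof.
move=> A B g f g_surj.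
pose s t := sval (cid (g_surj (f << 1 *g t >>))).
have sE t : g (s t) = f << 1 *g t >> by rewrite /s; case: cid.
exists (fglift s : {linear {freeg T / R} -> A}) => x /=.
rewrite -(freeg_sumE x) !raddf_sum; apply: eq_bigr => t _ /=.
by rewrite liftU linearZ /= sE -linearZ /= -freegUZ.
Qed.

Definition cover (M : lmodType R) : {linear {freeg M / R} -> M} :=
  fglift (id : M -> M).

Lemma cover_surj (M : lmodType R) (x : M) : exists y, cover M y = x.
Proof. by exists << 1 *g x >>; rewrite /cover /= liftU scale1r. Qed.

Definition ker_pred (M N : lmodType R) (f : {linear M -> N}) : {pred M} :=
  fun x => f x == 0.

Lemma ker_submod (M N : lmodType R) (f : {linear M -> N}) :
  submod_closed (ker_pred f).
Proof.
split=> [|a x y]; rewrite !unfold_in ?linear0 // => /eqP fx /eqP fy.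
by rewrite linearP fx fy scaler0 addr0.
Qed.

HB.instance Definition _ (M N : lmodType R) (f : {linear M -> N}) :=
  GRing.isSubmodClosed.Build R M (ker_pred f) (ker_submod f).

Definition syzygy1 (M : lmodType R) : lmodType R :=
  submodule (ker_pred (cover M)).

Section Resolution.
Context (M : lmodType R).

Fixpoint syzygy (i : nat) : lmodType R :=
  if i is j.+1 then syzygy1 (syzygy j) else M.

Definition free_mod (i : nat) : lmodType R := {freeg (syzygy i) / R}.

Definition free_d (i : nat) : {linear free_mod i.+1 -> free_mod i} :=
  (@submod_val R _ (ker_pred (cover (syzygy i)))) \o cover (syzygy i.+1).

Lemma free_exact (i : nat) (y : free_mod i) :
  cover (syzygy i) y = 0 <-> exists z, free_d i z = y.
Proof.
split=> [/eqP y0 | [z <-]]; last exact/eqP/(submod_valP (cover _ z)).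
have [z zE] := cover_surj 
  (@Submodule R (free_mod i) (ker_pred (cover (syzygy i))) y y0 : syzygy i.+1).
by exists z; rewrite /free_d /= zE.
Qed.

Lemma free_exactS (i : nat) (y : free_mod i.+1) :
  free_d i y = 0 <-> exists z, free_d i.+1 z = y.
Proof.
rewrite -free_exact; split=> [y0 | y0]; last by rewrite /free_d /= y0 linear0.
by apply: val_inj; rewrite /= -[RHS]y0.
Qed.

Definition free_resolution : proj_resolution M :=
  ProjResolution (fun i => @freeg_projective (syzygy i)) (cover_surj (M := M))
    (free_exact (i := 0%N)) free_exactS.

End Resolution.
End FreeResolution.
End FreeResolution.

Lemma proj_resolution_exists (R : comNzRingType) (M : lmodType R) :
  inhabited (proj_resolution M).
Proof. exact: (inhabits (FreeResolution.free_resolution M)). Qed.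

(* Main.v *)
Require Import Defs.
From HB Require Import structures.
From mathcomp Require Import all_boot all_order all_algebra.
From mathcomp Require Import all_classical.
From mathcomp Require Import ring.
From mathcomp Require freeg.

(** Why the theorem is true. A torsion-free module C of rank one is isomorphic
    to an ideal I, through an injective functional lam from C to R
    ([embedding_of_rank1]). Over a normal domain an endomorphism of I is
    multiplication by a fraction which is integral over R
    ([normal_homothetic]), so Hom(C, C) = R; this gives the
    direction from rank one and reflexive to semidualizing. For the converse,
    Hom(C, C) = R says that endomorphisms are homotheties ([homothetic_iso]).
    A torsion element, or a second independent element, would produce an
    endomorphism that is no homothety ([homothetic_torsion_free],
    [homothetic_embedding]), so C is again isomorphic to an ideal I.

    What remains, also for the last claim, is that a nonzero rigid ideal I is
    equal to its double inverse ([rigid_divisorial]). Suppose that y is in the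
    double inverse but not in I, with p = (I : y) prime. For nonzero x in I, the
    class of xy spans a copy of R/p in I/xI. As Ext^1(I, I) = 0, every
    homomorphism from I to I/xI is induced by multiplication by some rho in R
    ([Ext1_lift]). Apply this to the maps I -> R/p -> I/xI given by coordinates
    with respect to minimal generators of I at p ([local_basis_exists]). Then
    rho p is contained in xR while rho is not in xR, and normality yields a in p
    and s outside p with rho a = x s ([normal_prime_multiplier]): p is locally
    generated by a. Since all the scalars rho are now multiples of one of them
    up to a factor outside p, there is a single local generator e. Its
    coordinate is a functional f on I with f(e) outside p, whereas evaluating
    f at e by means of y in the double inverse puts s f(e) in aR, inside p.

    Associated primes, quotients C/xC and localizations are all expressed by
    elements: a congruence modulo xC, or a denominator outside p. *)

Set Implicit Arguments.
Unset Strict Implicit.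
Unset Printing Implicit Defensive.

Import GRing.Theory FracField.
Local Open Scope ring_scope.

(** * Ideals of a noetherian ring *)

Definition ideal_pred (R : comNzRingType) (p : R -> Prop) : Prop :=
  p 0 /\ forall a x y, p x -> p y -> p (a * x + y).

Definition prime_ideal (R : comNzRingType) (p : R -> Prop) : Prop :=
  [/\ ideal_pred p, ~ p 1 & forall a b, p (a * b) -> p a \/ p b].

Section Ideals.
Context (R : comNzRingType) (p : R -> Prop) (pI : ideal_pred p).

Lemma idealMl a x : p x -> p (a * x).
Proof. by case: pI => p0 pD px; rewrite -[a * x]addr0; apply: pD. Qed.

Lemma idealD x y : p x -> p y -> p (x + y).
Proof. by case: pI => _ pD px py; rewrite -[x]mul1r; apply: pD. Qed.

Lemma ideal_subC x y : p (x - y) -> p (y - x).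
Proof. by move=> pxy; rewrite -opprB -mulN1r; apply: idealMl. Qed.

Lemma ideal_transfer x y : p (x - y) -> p y -> p x.
Proof. by move=> pxy py; rewrite -[x](subrK y); apply: idealD. Qed.

Lemma ideal_sum n (a x : 'I_n -> R) :
  (forall i, p (x i)) -> p (\sum_(i < n) a i * x i).
Proof.
move=> px; apply: (big_ind p); [by case: pI | exact: idealD |].
by move=> i _; apply: idealMl.
Qed.

End Ideals.

Lemma noetherian_ideal_generators (R : comNzRingType) (p : R -> Prop) :
  noetherian R -> ideal_pred p ->
  exists (n : nat) (e : 'I_n -> R), (forall i, p (e i)) /\
    forall x, p x -> exists a : 'I_n -> R, x = \sum_(i < n) a i * e i.
Proof.
move=> noethR [p0 pD].
pose S : {pred R^o} := fun x => `[< p x >].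
have Sc : GRing.submod_closed S.
  by split=> [|a x y]; rewrite !unfold_in ?asboolE //= => px py; apply: pD.
pose I : ideal R := HB.pack S (GRing.isSubmodClosed.Build R R^o S Sc).
have [n [e eE]] := noethR I; exists n, (fun i => submod_val (e i)); split.
  by move=> i; apply/asboolP; exact: (submod_valP (e i)).
move=> x /asboolP px; have [a aE] := eE (@Submodule R R^o I x px).
exists a; move: (congr1 (@submod_val R R^o I) aE) => /= ->.
by rewrite (raddf_sum (@submod_val R R^o I)).
Qed.

(** Noetherianity is given through generators of ideals; what the proof uses is
    the maximal condition. *)
Lemma noetherian_maximal (R : comNzRingType) (F : (R -> Prop) -> Prop) p0 :
  noetherian R -> (forall p, F p -> ideal_pred p) -> F p0 ->
  exists2 p, F p &
    forall q, F q -> (forall x, p x -> q x) -> forall x, q x -> p x.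
Proof.
move=> noethR Fideal Fp0; apply: contrapT => nomax.
(* Otherwise every member has a strictly larger one; the union of the resulting
   chain c is generated by elements of a single c N, so the chain stops. *)
have step (p : {p | F p}) :
    {q : {q | F q} | (forall x, sval p x -> sval q x) /\
                     exists x, sval q x /\ ~ sval p x}.
  apply: cid; case: p => p Fp /=; apply: contrapT => nq; apply: nomax.
  exists p => // q Fq pq x qx; apply: contrapT => npx; apply: nq.
  by exists (exist _ q Fq); split=> //; exists x.
pose c n := iter n (fun p => sval (step p)) (exist F p0 Fp0).
have cS n x : sval (c n) x -> sval (c n.+1) x.
  by rewrite /c iterS; case: (step _) => q [/= + _]; apply.
have cle m n x : (m <= n)%N -> sval (c m) x -> sval (c n) x.
  move=> /subnK <-; elim: (n - m)%N => // k IH cx.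
  by rewrite addSn; apply: cS; exact: IH.
have cI n : ideal_pred (sval (c n)) by case: (c n) => q Fq; exact: Fideal.
have UI : ideal_pred (fun x => exists n, sval (c n) x).
  split=> [|a x y [m cx] [n cy]]; first by exists 0%N; case: (cI 0%N).
  exists (maxn m n); apply: (cI _).2.
    by apply: cle cx; rewrite leq_maxl.
  by apply: cle cy; rewrite leq_maxr.
have [n [e [eU eE]]] := noetherian_ideal_generators noethR UI.
pose N := (\max_(i < n) sval (cid (eU i)))%N.
have eN i : sval (c N) (e i).
  exact: cle (leq_bigmax (F := fun i => sval (cid (eU i))) i)
    (svalP (cid (eU i))).
have UN x : (exists k, sval (c k) x) -> sval (c N) x.
  by move=> /eE [a ->]; exact: ideal_sum.
have [_ [x [cx ncx]]] := svalP (step (c N)).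
by apply: ncx; apply: UN; exists N.+1.
Qed.

(** Existence of associated primes of M / N, without forming the quotient: a
    maximal element among the proper ideals (N : r m) is prime. *)
Lemma exists_prime_colon (R : comNzRingType) (M : lmodType R)
    (N : M -> Prop) m :
  noetherian R -> N 0 -> (forall a u v, N u -> N v -> N (a *: u + v)) ->
  ~ N m ->
  exists r, ~ N (r *: m) /\ prime_ideal (fun a => N (a *: (r *: m))).
Proof.
move=> noethR N0 ND Nm.
have NZ a u : N u -> N (a *: u) by move=> Nu; rewrite -[_ *: u]addr0; apply: ND.
have colonI u : ideal_pred (fun a => N (a *: u)).
  split=> [|a x y Nx Ny]; first by rewrite scale0r.
  by rewrite scalerDl -scalerA; apply: ND.
pose F q := exists r, ~ N (r *: m) /\ q = (fun a => N (a *: (r *: m))).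
have [p [r [Nr ->]] pmax] := @noetherian_maximal R F
  (fun a => N (a *: (1 *: m))) noethR
  ltac:(by move=> q [r [_ ->]]) ltac:(by exists 1; rewrite scale1r).
exists r; split=> //; split; [exact: colonI | by rewrite scale1r |].
move=> a b Nab; apply: contrapT => /not_orP [Na Nb]; apply: Na.
have Fq : F (fun c => N (c *: ((b * r) *: m))).
  by exists (b * r); split=> //; rewrite -scalerA.
apply: (pmax _ Fq) => [x Nx|]; last by rewrite -scalerA [a *: _]scalerA.
by rewrite -[(b * r) *: m]scalerA [x *: _]scalerA mulrC -scalerA; apply: NZ.
Qed.

(** Lets a linear map be described by the equations that it solves, such as
    division by a regular element or descent along a surjection. *)
Lemma linear_of_graph (R : comNzRingType) (M N : lmodType R)
    (G : M -> N -> Prop) :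
  (forall u, exists v, G u v) ->
  (forall a u v u' v', G u v -> G u' v' -> G (a *: u + u') (a *: v + v')) ->
  (forall v, G 0 v -> v = 0) ->
  exists g : {linear M -> N}, forall u, G u (g u).
Proof.
move=> Gex Glin G0; pose g u := sval (cid (Gex u)).
have gG u : G u (g u) := svalP (cid (Gex u)).
have Guniq u v v' : G u v -> G u v' -> v = v'.
  move=> Gv Gv'; apply/eqP; rewrite -subr_eq0 addrC -scaleN1r; apply/eqP/G0.
  by rewrite -[0](addNr u) -scaleN1r; apply: Glin.
have glin : linear g by move=> a u v; apply: Guniq (gG _) _; apply: Glin.
pose gL : {linear M -> N} := HB.pack g (GRing.isLinear.Build R M N _ g glin).
by exists gL.
Qed.

(** * Lifting homomorphisms through Ext, and normality *)

Section LiftThroughExt.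
Import freeg FreeResolution.

(** The long exact sequence of 0 -> N -> N -> N / x N -> 0, as far as it is
    needed: if Ext^1(M, N) = 0 then Hom(M, N) -> Hom(M, N / x N) is onto. A
    homomorphism to N / x N is encoded by a map psi to N that is linear modulo
    x N, so that no quotient module is formed. *)
Lemma Ext1_lift (R : comNzRingType) (M N : lmodType R) (x : R) (psi : M -> N) :
  Ext_eq0 1 M N -> (forall u : N, x *: u = 0 -> u = 0) ->
  (forall a u v, exists w, psi (a *: u + v) - (a *: psi u + psi v) = x *: w) ->
  exists h : {linear M -> N}, forall u, exists w, h u - psi u = x *: w.
Proof.
move=> ext xreg psi_lin.
pose P := free_resolution M.
pose F : {linear pr_mod P 0 -> N} :=
  (fglift psi : {linear {freeg M / R} -> N}).
(* F is the linear lift of psi to the free cover of M; FE compares them. *)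
have [w0 psi0] : exists w, psi 0 = x *: w.
  have [w] := psi_lin 1 0 0; rewrite !scale1r addr0 opprD addNKr => E.
  by exists (- w); rewrite scalerN -E opprK.
have FE (y : pr_mod P 0) : exists w, psi (pr_aug P y) - F y = x *: w.
  rewrite -(freeg_sumE y).
  apply: (big_ind (fun y => exists w, psi (pr_aug P y) - F y = x *: w)).
  - by exists w0; rewrite (linear0 (pr_aug P)) (linear0 F) subr0.
  - move=> y1 y2 [w1 E1] [w2 E2].
    have [w] := psi_lin 1 (pr_aug P y1) (pr_aug P y2); rewrite !scale1r => E.
    exists (w + w1 + w2); rewrite !scalerDr -E -E1 -E2.
    rewrite (linearD (pr_aug P)) (linearD F) /=.
    by rewrite -addrA (addrACA (psi (pr_aug P y1))) -opprD subrKA.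
  move=> t _; set c := coeff _ _.
  have [w E] := psi_lin c t 0; exists (w + w0).
  rewrite scalerDr -E -psi0 addr0 /F /= /cover /= !liftU.
  by rewrite opprD addrA subrK.
(* On cycles F is divisible by x, and the quotient f is a cocycle. Writing
   f = g o d, the map F - x g kills the cycles and descends to M. *)
have [f fE] : exists f : {linear pr_mod P 1 -> N},
    forall z, x *: f z = F (pr_d P 0 z).
  apply: (linear_of_graph (G := fun z v => x *: v = F (pr_d P 0 z)))
    => [z|a u v u' v' E E'|v].
  - have [w E] := FE (pr_d P 0 z).
    have dz : pr_aug P (pr_d P 0 z) = 0 by apply/pr_exact0; exists z.
    exists (w0 - w); rewrite scalerBr -E dz psi0 opprB addrC subrK //.
  - by rewrite scalerDr scalerA mulrC -scalerA E E' !linearP.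
  - by rewrite !linear0 => /xreg.
have fcocycle : cocycle f.
  move=> y; apply: xreg; rewrite fE.
  suff -> : pr_d P 0 (pr_d P 1 y) = 0 by rewrite linear0.
  by apply/pr_exactS; exists y.
have [g gE] := ext P f fcocycle.
have [h hE] : exists h : {linear M -> N},
    forall u, exists2 y, pr_aug P y = u & h u = F y - x *: g y.
  apply: (linear_of_graph
    (G := fun u v => exists2 y, pr_aug P y = u & v = F y - x *: g y))
    => [u|a u v u' v' [y <- ->] [y' <- ->]|v [y y0 ->]].
  - by have [y <-] := pr_aug_surj P u; exists (F y - x *: g y), y.
  - exists (a *: y + y'); first exact: linearP.
    rewrite (linearP F) (linearP g) [in RHS]scalerDr opprD scalerBr !scalerA.
    by rewrite [x * a]mulrC addrACA.
  - move/pr_exact0: y0 => [z <-]; rewrite -fE gE subrr //.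
exists h => u; have [y <- ->] := hE u; have [w E] := FE y.
exists (- w - g y); rewrite scalerBr scalerN -E opprB addrAC //.
Qed.

End LiftThroughExt.

(** beta / alpha stabilizes the ideal generated by the w k; by Cayley-Hamilton
    it is integral over R, being an eigenvalue of a matrix over R. *)
Lemma normal_divides (R : idomainType) n (w : 'I_n -> R) i0 (alpha beta : R) :
  normal_domain R -> w i0 != 0 -> alpha != 0 ->
  (forall j, exists a : 'I_n -> R,
     beta * w j = alpha * \sum_(k < n) a k * w k) ->
  exists c, beta = alpha * c.
Proof.
move=> normR w0 alpha0 /choice[a aE].
pose A : 'M[R]_n := \matrix_(k, j) a j k.
have alphaF0 : tofrac alpha != 0 by rewrite tofrac_eq0.
have [|c cE] := normR (tofrac beta / tofrac alpha).
  exists (char_poly A); first exact: char_poly_monic.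
  rewrite (map_char_poly (@tofrac R)) -eigenvalue_root_char.
  apply/eigenvalueP; exists (\row_j tofrac (w j)); last first.
    apply/negP => /eqP/rowP/(_ i0); rewrite !mxE => /eqP.
    by rewrite tofrac_eq0 (negbTE w0).
  apply/rowP => j; rewrite [LHS]mxE !mxE.
  transitivity (tofrac (\sum_k a j k * w k)).
    rewrite (raddf_sum (@tofrac R)); apply: eq_bigr => k _.
    by rewrite !mxE mulrC; apply/esym/tofracM.
  have E := congr1 (@tofrac R) (aE j); rewrite !tofracM in E.
  by apply: (mulfI alphaF0); rewrite -E mulrA [tofrac alpha * _]mulrC divfK.
exists c; apply/eqP; rewrite -tofrac_eq; apply/eqP.
by rewrite tofracM -cE mulrC divfK.
Qed.

(** * Minimal generators at a prime *)

Section LocalBasis.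
Context (R : comNzRingType) (C : lmodType R) (p : R -> Prop).

Lemma relations_neq0 (n : nat) (e : 'I_n -> C) i :
  (forall a : 'I_n -> R, \sum_(i < n) a i *: e i = 0 -> forall i, p (a i)) ->
  ~ p 1 -> e i != 0.
Proof.
move=> rel p1; apply/eqP => ei0; apply: p1.
have /rel/(_ i) : \sum_(j < n) (i == j)%:R *: e j = 0.
  rewrite (bigD1 i) //= eqxx ei0 scaler0 add0r big1 // => j ji.
  by rewrite eq_sym (negbTE ji) scale0r.
by rewrite eqxx.
Qed.

(** The e i are, after localizing at p, a minimal generating family of C. They
    generate up to the single denominator s, the relations between them have
    coefficients in p, and r records coordinates, which are determined modulo p.
    For p = 0 this is a maximal linearly independent family. *)
Definition local_basis (n : nat) (e : 'I_n -> C) (s : R) (r : C -> 'I_n -> R) :=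
  [/\ ~ p s, forall u, s *: u = \sum_(i < n) r u i *: e i
    & forall a : 'I_n -> R, \sum_(i < n) a i *: e i = 0 -> forall i, p (a i)].

(** A generating family (up to a denominator outside p) with the least possible
    number of elements. This replaces Nakayama's lemma. *)
Lemma local_basis_exists :
  finitely_generated C -> prime_ideal p -> exists n e s r, @local_basis n e s r.
Proof.
move=> [n0 [e0 e0E]] [pI p1 pM].
pose gen n := `[< exists (e : 'I_n -> C) s, ~ p s /\
  forall u, exists a : 'I_n -> R, s *: u = \sum_(i < n) a i *: e i >].
have gen0 : gen n0.
  by apply/asboolP; exists e0, 1; split=> // u; rewrite scale1r; exact: e0E.
have [n /asboolP [e [s [ps /choice [r rE]]]] nmin] :=
  ex_minnP (ex_intro gen n0 gen0).
exists n, e, s, r; split=> // a aE k; apply: contrapT => pak.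
have n_gt0 : (0 < n)%N by case: n {e rE a aE pak nmin r} k => [[]|].
have : gen n.-1; last by move=> /nmin; rewrite leqNgt ltn_predL n_gt0.
(* A relation with a k outside p eliminates the generator e k, after replacing
   s by a k * s. *)
apply/asboolP; exists (fun j => e (lift k j)), (a k * s); split.
  by move=> /pM [].
move=> u; exists (fun j => a k * r u (lift k j) - r u k * a (lift k j)).
rewrite -scalerA rE; move: aE; rewrite !(bigD1_ord k) //= => /eqP.
rewrite addr_eq0 => /eqP aE.
rewrite scalerDr scalerA mulrC -scalerA aE scalerN !scaler_sumr addrC -sumrB.
by apply: eq_bigr => j _; rewrite scalerBl !scalerA.
Qed.

Context (n : nat) (e : 'I_n -> C) (s : R) (r : C -> 'I_n -> R).
Hypothesis eB : local_basis e s r.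

Lemma local_coord_linear a u v i : p (r (a *: u + v) i - (a * r u i + r v i)).
Proof.
have [_ rE rel] := eB.
apply: (rel (fun i => r (a *: u + v) i - (a * r u i + r v i))).
under eq_bigr => j _ do rewrite scalerBl scalerDl -scalerA.
rewrite sumrB big_split /= -scaler_sumr -!rE scalerDr !scalerA [s * a]mulrC.
by rewrite subrr.
Qed.

Lemma local_coord_basis i j : p (r (e i) j - s * (i == j)%:R).
Proof.
have [_ rE rel] := eB.
apply: (rel (fun j => r (e i) j - s * (i == j)%:R)).
under eq_bigr => k _ do rewrite scalerBl -scalerA.
rewrite sumrB -rE -scaler_sumr (bigD1 i) //= eqxx scale1r big1 ?addr0 ?subrr //.
by move=> k ki; rewrite eq_sym (negbTE ki) scale0r.
Qed.

Lemma local_coord_diag i : prime_ideal p -> ~ p (r (e i) i).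
Proof.
move=> [pI _ _] pr; have [ps _ _] := eB.
apply: ps; apply: (ideal_transfer pI) pr; apply: (ideal_subC pI).
by have := local_coord_basis i i; rewrite eqxx mulr1.
Qed.

(** When p annihilates m, a coordinate gives a map C -> R / p -> R m. It is
    nonzero if the annihilator of m is p. *)
Lemma local_coord_linear_map (N : lmodType R) (m : N) i :
  (forall a, p a -> a *: m = 0) ->
  exists phi : {linear C -> N}, forall u, phi u = r u i *: m.
Proof.
move=> pm; have rmul x y : p (x - y) -> x *: m = y *: m.
  by move=> /pm /eqP; rewrite scalerBl subr_eq0 => /eqP.
have lin : linear (fun u => r u i *: m).
  move=> a u v; rewrite (rmul _ _ (local_coord_linear a u v i)).
  by rewrite scalerDl -scalerA.
pose phi : {linear C -> N} :=
  HB.pack (fun u => r u i *: m) (GRing.isLinear.Build R C N _ _ lin).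
by exists phi.
Qed.

End LocalBasis.

(** * Modules isomorphic to ideals *)

Definition torsion_free (R : idomainType) (C : lmodType R) : Prop :=
  forall (a : R) (u : C), a *: u = 0 -> a = 0 \/ u = 0.

Lemma zero_prime (R : idomainType) : prime_ideal (fun a : R => a = 0).
Proof.
split; last 1 first.
- by move=> a b /eqP; rewrite mulf_eq0 => /orP [] /eqP; [left | right].
- by split=> // a x y -> ->; rewrite mulr0 addr0.
- by apply/eqP; rewrite oner_eq0.
Qed.

Lemma torsion_free_of_embedding (R : idomainType) (C : lmodType R)
    (lam : {linear C -> R^o}) : injective lam -> torsion_free C.
Proof.
move=> lam_inj a u au; have [->|a0] := eqVneq a 0; [by left | right].
apply: lam_inj; rewrite linear0; apply: (mulfI a0); rewrite mulr0.
by have := linearZ_LR lam a u; rewrite au linear0.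
Qed.

(** A maximal independent family has at most one element e 0, so up to a
    denominator C is contained in R e 0, and the coordinate identifies it with
    an ideal. *)
Lemma embedding_of_rank1 (R : idomainType) (C : lmodType R) :
  finitely_generated C -> torsion_free C -> has_rank C 1 ->
  exists lam : {linear C -> R^o}, injective lam.
Proof.
move=> fgC tfC [_ rank_le1].
have [n [e [s [r eB]]]] := local_basis_exists fgC (zero_prime R).
have [/eqP s0 rE rel] := eB.
have n1 : (n <= 1)%N := rank_le1 n e rel.
have [lam lamE] : exists lam : {linear C -> R^o},
    forall u, s *: u = \sum_(i < n) lam u *: e i.
  case: n n1 e r rel rE eB => [|[|//]] _ e r rel rE eB.
    by exists (\0 : C -> R^o) => u; rewrite rE !big_ord0.
  have [a ->|lam lamE] := local_coord_linear_map eB (N := R^o) (m := 1) 0.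
    by rewrite scale0r.
  exists lam => u; rewrite rE !big_ord1 lamE.
  by rewrite [r u 0 *: 1]mulr1.
exists lam => u v Euv; apply/eqP; rewrite -subr_eq0; apply/eqP.
have /tfC[/eqP|//] : s *: (u - v) = 0 by rewrite scalerBr !lamE Euv subrr.
by rewrite (negbTE s0).
Qed.

(** A module embedded in R by lam behaves like an ideal: any two of its elements
    are proportional, with coefficients given by lam. *)
Lemma embedding_swap (R : comNzRingType) (C : lmodType R)
    (lam : {linear C -> R^o}) u v :
  injective lam -> (lam v : R) *: u = (lam u : R) *: v.
Proof.
by move=> lam_inj; apply: lam_inj; rewrite !linearZ_LR /= [LHS]mulrC.
Qed.

Lemma has_rank1_of_embedding (R : idomainType) (C : lmodType R)
    (lam : {linear C -> R^o}) (v0 : C) :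
  injective lam -> v0 != 0 -> has_rank C 1.
Proof.
move=> lam_inj v0N; have tfC := torsion_free_of_embedding lam_inj; split.
  exists (fun=> v0) => a; rewrite big_ord1 => /tfC [a0 i|/eqP].
    by rewrite ord1.
  by rewrite (negbTE v0N).
move=> [|[|m]] e eI //.
pose i1 : 'I_m.+2 := lift ord0 ord0.
pose a i : R :=
  if i == ord0 then lam (e i1) else if i == i1 then - lam (e ord0) else 0.
have /eI/(_ i1) : \sum_(i < m.+2) a i *: e i = 0.
  rewrite (bigD1 ord0) //= (bigD1 i1) //= big1 ?addr0 => [|i /andP [i0 ii1]].
    by rewrite /a !eqxx /= scaleNr (embedding_swap _ _ lam_inj) subrr.
  by rewrite /a (negbTE i0) (negbTE ii1) scale0r.
rewrite /a eqxx /= => /eqP; rewrite oppr_eq0 => /eqP l0.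
have /eqP[] :=
  relations_neq0 (p := fun a => a = 0) ord0 eI (elimN eqP (oner_neq0 R)).
by apply: lam_inj; rewrite l0 linear0.
Qed.

Lemma bijective_of_inj_surj (A B : Type) (f : A -> B) :
  injective f -> (forall b, exists a, f a = b) -> bijective f.
Proof.
move=> f_inj /choice [g gK]; exists g => // a.
by apply: f_inj; rewrite gK.
Qed.

(** * Modules whose endomorphisms are homotheties *)

(** The concrete meaning of Hom(C, C) = R: each endomorphism is multiplication
    by a unique scalar. *)
Definition homothetic (R : comNzRingType) (C : lmodType R) : Prop :=
  (forall f : {linear C -> C}, exists c, forall u, f u = c *: u) /\
  (forall a : R, (forall u : C, a *: u = 0) -> a = 0).

(** An abstract isomorphism of modules Hom(C, C) = R suffices: the endomorphism
    g that corresponds to 1 generates Hom(C, C), and as the identity is a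
    multiple of g, g itself is a homothety. *)
Lemma homothetic_iso (R : comNzRingType) (C : lmodType R) :
  homothetic C <-> isomorphic (HomR C C) R^o.
Proof.
split=> [[endo faithful] | [phi [phi' phiK phi'K]]].
  have [phi phiE] : exists phi : {linear HomR C C -> R^o},
      forall f : HomR C C, forall u, (f : {linear C -> C}) u = (phi f : R) *: u.
    apply: (linear_of_graph (G := fun (f : HomR C C) (c : R^o) =>
        forall u, (f : {linear C -> C}) u = (c : R) *: u))
      => [f|a f c f' c' fE f'E u|c cE].
    - exact: (endo f).
    - rewrite scalerDl -[(a *: c : R^o)]/(a * c) -scalerA -fE -f'E //.
    - by apply: faithful => u; rewrite -cE.
  exists phi; apply: bijective_of_inj_surj => [f f' E|c].
    by apply: homR_ext => u; rewrite (phiE f) (phiE f') E.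
  pose id : HomR C C := (idfun : {linear C -> C}).
  exists ((c : R) *: id); apply/eqP; rewrite -subr_eq0; apply/eqP/faithful => u.
  by rewrite scalerBl -phiE subrr.
pose g := phi' 1.
have phig : phi g = 1 by rewrite /g phi'K.
have gE (f : HomR C C) u :
    (f : {linear C -> C}) u = (phi f : R) *: (g : {linear C -> C}) u.
  suff {1}-> : f = (phi f : R) *: g by [].
  by apply: (can_inj phiK); rewrite linearZ_LR phig [RHS]mulr1.
have faithful (a : R) : (forall u : C, a *: u = 0) -> a = 0.
  move=> a0; have : phi (a *: g) = 0.
    rewrite -(linear0 phi); congr (phi _); apply: homR_ext => u; exact: a0.
  by rewrite linearZ_LR phig [X in X = _]mulr1.
split=> // f.
pose i := phi (idfun : {linear C -> C}).
pose j := phi (g \o g : {linear C -> C}).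
(* Applied to id and to g o g, gE gives u = i g u and g (g u) = j g u; hence
   g u = i g (g u) = j u. *)
have gj u : (g : {linear C -> C}) u = j *: u.
  have -> : (g : {linear C -> C}) u =
      i *: (g : {linear C -> C}) ((g : {linear C -> C}) u).
    exact: (gE (idfun : {linear C -> C}) ((g : {linear C -> C}) u)).
  have /= := gE (g \o g : {linear C -> C}) u; rewrite -/j => ->.
  rewrite scalerA mulrC -scalerA; congr (_ *: _).
  exact/esym/(gE (idfun : {linear C -> C})).
by exists ((phi f : R) * j) => u; rewrite gE gj scalerA.
Qed.

Lemma homothetic_neq0 (R : comNzRingType) (C : lmodType R) :
  homothetic C -> exists v0 : C, v0 != 0.
Proof.
move=> [_ faithful]; apply: contrapT => none.
have /eqP := oner_neq0 R; apply; apply/faithful => u; rewrite scale1r.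
by apply: contrapT => /eqP u0; apply: none; exists u.
Qed.

Lemma homothetic_local_basis (R : comNzRingType) (C : lmodType R)
    (p : R -> Prop) n (e : 'I_n -> C) s r :
  homothetic C -> p 0 -> local_basis p e s r -> (0 < n)%N.
Proof.
move=> [_ faithful] p0 [ps rE _]; case: n e r rE => // e r rE.
by case: ps; rewrite (faithful s) // => u; rewrite rE big_ord0.
Qed.

(** If a kills a nonzero element, some multiple m' of it has a prime
    annihilator p that contains a. A coordinate at p gives a nonzero
    endomorphism with image in R m', hence killed by a; but a nonzero homothety
    is not killed by a. *)
Lemma homothetic_torsion_free (R : idomainType) (C : lmodType R) :
  noetherian R -> finitely_generated C -> homothetic C -> torsion_free C.
Proof.
move=> noethR fgC homC a m am; apply: contrapT => /not_orP [a0 m0].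
have [r [rm0 pP]] := @exists_prime_colon _ _ (fun u : C => u = 0) m noethR
  (erefl _) ltac:(by move=> b u v -> ->; rewrite scaler0 addr0) m0.
set p := (fun b => _) in pP; have [pI p1 pM] := pP.
have [n [e [s [c eB]]]] := local_basis_exists fgC pP.
have n_gt0 := homothetic_local_basis homC pI.1 eB.
pose i := Ordinal n_gt0.
have [//|phi phiE] := local_coord_linear_map eB (m := r *: m) i.
have [endo faithful] := homC.
have [b bE] := endo phi.
have b0 : b = 0.
  have /eqP : a * b = 0.
    apply: faithful => u; rewrite -scalerA -bE phiE !scalerA -mulrA mulrC.
    by rewrite -scalerA am scaler0.
  by rewrite mulf_eq0 => /orP [] /eqP.
apply: (local_coord_diag eB (i := i) pP).
by rewrite /p -phiE bE b0 scale0r.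
Qed.

(** Take a maximal independent family. The endomorphism sending u to its first
    coordinate times e 0 is a nonzero homothety, which is injective because C is
    torsion-free; so this coordinate is an embedding of C in R. *)
Lemma homothetic_embedding (R : idomainType) (C : lmodType R) :
  finitely_generated C -> homothetic C -> torsion_free C ->
  exists lam : {linear C -> R^o}, injective lam.
Proof.
move=> fgC homC tfC.
have [n [e [s [r eB]]]] := local_basis_exists fgC (zero_prime R).
pose i := Ordinal (homothetic_local_basis homC (erefl 0) eB).
have [[endo faithful] [/eqP s0 rE rel]] := (homC, eB).
have [a ->|phi phiE] := local_coord_linear_map eB (m := e i) i.
  by rewrite scale0r.
have [a ->|lam lamE] := local_coord_linear_map eB (N := R^o) (m := 1) i.
  by rewrite scale0r.
have [c cE] := endo phi.
have ei0 : e i != 0 :=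
  relations_neq0 (p := fun a => a = 0) i rel (elimN eqP (oner_neq0 R)).
have c0 : c != 0.
  apply: contra_neq s0 => c0.
  have /eqP := local_coord_basis eB i i; rewrite eqxx mulr1 subr_eq0 => /eqP <-.
  have /tfC [//|/eqP] : r (e i) i *: e i = 0 by rewrite -phiE cE c0 scale0r.
  by rewrite (negbTE ei0).
exists lam => u v Euv; apply/eqP; rewrite -subr_eq0; apply/eqP.
have /tfC[/eqP|//] : c *: (u - v) = 0; last by rewrite (negbTE c0).
have rE' w : r w i = lam w by rewrite lamE [RHS]mulr1.
by rewrite scalerBr -!cE !phiE !rE' Euv subrr.
Qed.

(** An ideal over a normal domain satisfies (I : I) = R. *)
Lemma normal_homothetic (R : idomainType) (C : lmodType R)
    (lam : {linear C -> R^o}) (v0 : C) :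
  normal_domain R -> finitely_generated C -> injective lam -> v0 != 0 ->
  homothetic C.
Proof.
move=> normR [n [e eE]] lam_inj v0N.
have tfC := torsion_free_of_embedding lam_inj.
split=> [f|a aC]; last first.
  by have [//|/eqP] := tfC a v0 (aC v0); rewrite (negbTE v0N).
have lv0 : (lam v0 : R) != 0.
  by apply: contra_neq v0N => l0; apply: lam_inj; rewrite l0 linear0.
(* f acts on the ideal lam(C) as multiplication by lam (f v0) / lam v0. *)
have fE u : (lam v0 : R) * lam (f u) = lam (f v0) * lam u.
  have := congr1 (fun w => lam (f w)) (embedding_swap u v0 lam_inj).
  by rewrite !linearZ_LR => E; apply: etrans E (mulrC _ _).
have lE u a : u = \sum_(i < n) a i *: e i ->
    lam u = \sum_(i < n) a i * lam (e i) :> R.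
  move=> ->; rewrite (raddf_sum lam); apply: eq_bigr => i _.
  exact: linearZ_LR.
have [i0 wi0] : exists i0, lam (e i0) != 0 :> R.
  apply: contrapT => none; case/eqP: lv0; have [a /lE ->] := eE v0.
  apply: big1 => i _; suff -> : lam (e i) = 0 by rewrite mulr0.
  by apply: contrapT => /eqP li; apply: none; exists i.
have [|c cE] := normal_divides (R := R) (w := fun i => lam (e i))
  (beta := lam (f v0)) normR wi0 lv0.
  by move=> j; have [a /lE aE] := eE (f (e j)); exists a; rewrite -fE -aE.
exists c => u; apply: lam_inj; apply: (mulfI lv0).
by rewrite fE cE -mulrA; congr (_ * _); exact/esym/linearZ_LR.
Qed.

(** * Rigid ideals are divisorial *)

Lemma homothetic_divides (R : idomainType) (C : lmodType R) (x a : R) :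
  homothetic C -> torsion_free C -> x != 0 ->
  (forall u : C, exists w, a *: u = x *: w) -> exists c, a = x * c.
Proof.
move=> [endo faithful] tfC x0 aC.
have [h hE] : exists h : {linear C -> C}, forall u, a *: u = x *: h u.
  apply: (linear_of_graph (G := fun u w => a *: u = x *: w))
    => // [b u v u' v' E E'|v].
    by rewrite !scalerDr !scalerA ![_ * b]mulrC -!scalerA E E'.
  by rewrite scaler0 => /esym /tfC [/eqP|//]; rewrite (negbTE x0).
have [c cE] := endo h; exists c.
apply/eqP; rewrite -subr_eq0; apply/eqP/faithful => u.
by rewrite scalerBl hE cE scalerA subrr.
Qed.

(** If q = rho / x is outside R and q p is contained in R, then q p is not
    contained in p, for otherwise q would be integral. When p is prime this
    makes p principal after localization: s / a = q with s outside p shows that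
    a generates it. *)
Lemma normal_prime_multiplier (R : idomainType) (p : R -> Prop) (x rho : R) :
  noetherian R -> normal_domain R -> ideal_pred p -> p x -> x != 0 ->
  (forall c, rho <> x * c) -> (forall a, p a -> exists c, rho * a = x * c) ->
  exists a s, [/\ p a, ~ p s & rho * a = x * s].
Proof.
move=> noethR normR pI px x0 rhoN rhop; apply: contrapT => none.
have [n [e [ep eE]]] := noetherian_ideal_generators noethR pI.
have [i0 ei0] : exists i, e i != 0.
  apply: contrapT => nz; have [a xE] := eE x px; case/eqP: x0; rewrite xE.
  apply: big1 => i _; suff -> : e i = 0 by rewrite mulr0.
  by apply: contrapT => /eqP ei; apply: nz; exists i.
have [|c /rhoN //] := normal_divides (beta := rho) normR ei0 x0.
move=> j; have [s sE] := rhop _ (ep j).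
have [a aE] : exists a : 'I_n -> R, s = \sum_(i < n) a i * e i.
  by apply: eE; apply: contrapT => ps; apply: none; exists (e j), s.
by exists a; rewrite -aE.
Qed.

(** The condition on y says that y belongs to the double inverse of the ideal
    I = lam(C). If y were outside I then, for p = (I : y) prime, rigidity would
    turn each local coordinate C -> R / p = (R y + I) / I into a scalar
    multiplying p into x R, so that p becomes principal and C generated by one
    element after localizing at p. Over such a discrete valuation ring y lies
    in I, a contradiction. *)
Lemma rigid_divisorial (R : idomainType) (C : lmodType R)
    (lam : {linear C -> R^o}) (v0 : C) (y : R) :
  noetherian R -> normal_domain R -> finitely_generated C ->
  injective lam -> v0 != 0 -> Ext_eq0 1 C C ->
  (forall (f : {linear C -> R^o}) v, exists c : R, (f v : R) * y = lam v * c) ->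
  exists w, lam w = y.
Proof.
move=> noethR normR fgC lam_inj v0N extC; pose l u : R := lam u.
have lZ a u : l (a *: u) = a * l u by exact: linearZ_LR.
have lB u v : l (u - v) = l u - l v by exact: linearB.
have l_eq0 u : (l u == 0) = (u == 0).
  apply/eqP/eqP => [lu|->]; last exact: linear0.
  by apply: lam_inj; rewrite linear0.
have swap u v : l v *: u = l u *: v := embedding_swap u v lam_inj.
have homC := normal_homothetic normR fgC lam_inj v0N.
have tfC := torsion_free_of_embedding lam_inj.
move=> y_div; apply: contrapT => yI.
have I0 : exists w, lam w = 0 by exists 0; exact: linear0.
have ID a u v : (exists w, lam w = u) -> (exists w, lam w = v) ->
    exists w, lam w = a *: u + v.
  by move=> [w <-] [w' <-]; exists (a *: w + w'); rewrite linearP.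
(* Replacing y by a multiple, the ideal (lam(C) : y) is a prime p. *)
have [b [byI pP]] := exists_prime_colon noethR I0 ID yI.
have {y_div} : forall (f : {linear C -> R^o}) v,
    exists c : R, (f v : R) * (b * y) = l v * c.
  move=> f v; have [c E] := y_div f v; exists (b * c).
  by rewrite mulrCA E mulrCA.
move: byI pP; rewrite -[b *: _]/(b * y); move: (b * y) => {yI}{}y yI.
set p := (fun a => _) => pP y_div; have [pI p1 pM] := pP.
have [n [e [t [r eB]]]] := local_basis_exists fgC pP.
have n_gt0 := homothetic_local_basis homC pI.1 eB.
pose i0 := Ordinal n_gt0; have [pt rE rel] := eB.
have prii i : ~ p (r (e i) i) := local_coord_diag eB pP.
pose x := l v0; have x0 : x != 0 by rewrite l_eq0.
(* z stands for x y: it lies in lam(C), and (x lam(C) : x y) = p. *)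
pose z := y *: v0.
have zp a w : a *: z = x *: w -> p a.
  move=> /(congr1 l); rewrite !lZ => E; exists w; apply: (mulfI x0).
  exact: etrans (esym E) (etrans (mulrA _ _ _) (mulrC _ _)).
have pz a : p a -> exists w, a *: z = x *: w.
  by move=> [w wE]; exists w; rewrite /z scalerA (esym wE : a * y = l w) swap.
have px : p x by exists z; rewrite -[lam z]/(l z) lZ mulrC.
have lz : l z = y * x by rewrite lZ.
clearbody z.
(* The class of z in C / x C has annihilator p, so u |-> r u i *: z is a
   homomorphism from C to C / x C. Rigidity lifts it to an endomorphism, which
   is multiplication by a scalar rho i. *)
have /choice [rho rhoE] : forall i, exists rho, forall u, exists w,
    rho *: u - r u i *: z = x *: w.
  move=> i.
  have [u xu|a u v|h hE] := @Ext1_lift _ C C x (fun u => r u i *: z) extC.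
  - by have [/eqP|//] := tfC _ _ xu; rewrite (negbTE x0).
  - rewrite /= scalerA -scalerDl -scalerBl; apply: pz.
    exact: local_coord_linear eB _ _ _ _.
  by have [c cE] := homC.1 h; exists c => u; rewrite -cE; apply: hE.
have rho_p i a : p a -> exists c, rho i * a = x * c.
  move=> pa; apply: (homothetic_divides homC tfC x0) => u.
  have [w wE] := rhoE i u; have [w' w'E] := pz a pa.
  exists (a *: w + r u i *: w').
  rewrite scalerDr !scalerA ![x * _]mulrC -!scalerA.
  by rewrite -wE -w'E scalerBr !scalerA ![_ * a]mulrC subrK.
have [|a [s [pa ps asE]]] := normal_prime_multiplier (rho := rho i0)
  noethR normR pI px x0 _ (rho_p i0).
  move=> c cE; have [w wE] := rhoE i0 (e i0).
  apply: (prii i0); apply: (zp _ (c *: e i0 - w)).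
  by rewrite scalerBr -wE cE scalerA opprB addrC subrK.
have a0 : a != 0.
  apply: contra_not_neq ps => a0; move/eqP: asE.
  by rewrite a0 mulr0 eq_sym mulf_eq0 (negbTE x0) => /eqP ->; exact: pI.1.
(* Two coordinates i and i0 would be proportional mod p: with a * rho i = x * c,
   comparing c * rho i0 = s * rho i on all u gives s * r u i = c * r u i0 mod p.
   Taking u = e i, where r u i0 is in p and r u i is not, this contradicts
   s not in p. *)
have all_i0 i : i = i0.
  apply: contrapT => /eqP ii0; have [c cE] := rho_p i a pa.
  have crho : c * rho i0 = s * rho i.
    apply: (mulfI a0); rewrite !(mulrCA a) !(mulrC a) asE cE.
    by rewrite mulrCA [RHS]mulrC -mulrA.
  have pcoord u : p (s * r u i - c * r u i0).
    have [w wE] := rhoE i u; have [w' w'E] := rhoE i0 u.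
    apply: (zp _ (c *: w' - s *: w)).
    rewrite scalerBr !scalerA ![x * _]mulrC -!scalerA -wE -w'E.
    rewrite !scalerBr !scalerA crho.
    by rewrite opprB [in RHS]addrC addrA subrK scalerBl.
  have pr0 : p (r (e i) i0).
    by have := local_coord_basis eB i i0; rewrite (negbTE ii0) mulr0 subr0.
  have /pM [//|] : p (s * r (e i) i); last exact: prii.
  by apply: (ideal_transfer pI) (pcoord (e i)) _; exact: (idealMl pI).
(* C is therefore generated by e i0 away from p, and the only coordinate is a
   linear functional f. *)
have tE u : t *: u = r u i0 *: e i0.
  rewrite rE (bigD1 i0) //= big1 ?addr0 // => i /eqP[]; exact: all_i0.
have e0 : e i0 != 0 := relations_neq0 i0 rel p1.
have [f fE] : exists f : {linear C -> R^o},
    forall u, t *: u = (f u : R) *: e i0.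
  apply: (linear_of_graph (G := fun u (c : R^o) => t *: u = (c : R) *: e i0)).
  - by move=> u; exists (r u i0).
  - move=> c u v u' v' E E'; rewrite scalerDr scalerA mulrC -scalerA E E'.
    by rewrite scalerDl -scalerA.
  - by move=> c; rewrite scaler0 => /esym/tfC [//|/eqP]; rewrite (negbTE e0).
have fe0 : f (e i0) = t.
  apply/eqP; rewrite -subr_eq0.
  have /tfC [->//|/eqP] : ((f (e i0) : R) - t) *: e i0 = 0.
    by rewrite scalerBl -fE subrr.
  by rewrite (negbTE e0).
have [w wE] := rhoE i0 (e i0); have [c cE] := y_div f (e i0).
have fw : l w * f (e i0) = l (e i0) * f w.
  by have := congr1 f (swap (e i0) w); rewrite !linearZ_LR.
have le0 : l (e i0) != 0 by rewrite l_eq0.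
(* Apply lam to rho i0 *: e i0 = r (e i0) i0 *: z + x *: w and multiply by
   a * f (e i0): the hypothesis on y makes both sides divisible by
   x * l (e i0), and cancelling leaves a right side in a R. *)
have st : s * t = a * (r (e i0) i0 * c + f w).
  move: wE cE fw => /(congr1 l) + cE fw.
  rewrite lB !lZ lz fe0 in cE fw * => /(canRL (subrK _)) rhol.
  apply: (mulfI x0); apply: (mulfI le0); rewrite [x * (s * t)]mulrA -asE.
  transitivity (a * t * (rho i0 * l (e i0))); first by ring.
  transitivity
    (a * x * (r (e i0) i0 * (l (e i0) * c) + l (e i0) * (f w : R))).
    by rewrite rhol -cE -fw; ring.
  by move: (f w : R) => fwR; ring.
have /pM [//|//] : p (s * t).
rewrite st mulrC; exact: (idealMl pI).
Qed.

(** * Reflexivity *)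

Lemma reflexive_of_evaluation (R : comNzRingType) (M : lmodType R) :
  finitely_generated M ->
  (forall u : M, (forall f : {linear M -> R^o}, f u = 0) -> u = 0) ->
  (forall Th : {linear dual M -> R^o}, exists w,
     forall f : dual M, Th f = (f : {linear M -> R^o}) w) ->
  reflexive_module M.
Proof.
move=> fgM ev_inj ev_surj; split=> //.
have [ev evE] : exists ev : {linear M -> dual (dual M)}, forall u (f : dual M),
    (ev u : {linear dual M -> R^o}) f = (f : {linear M -> R^o}) u.
  apply: (linear_of_graph (G := fun u (Th : dual (dual M)) => forall f : dual M,
    (Th : {linear dual M -> R^o}) f = (f : {linear M -> R^o}) u)).
  - move=> u; have [Th ThE] := linear_of_graph
      (G := fun (f : dual M) (c : R^o) => c = (f : {linear M -> R^o}) u)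
      ltac:(by move=> f; exists ((f : {linear M -> R^o}) u))
      ltac:(by move=> a f c f' c' -> ->) ltac:(by move=> c ->).
    by exists Th.
  - by move=> a u Th u' Th' E E' f; rewrite linearP -E -E'.
  - by move=> Th Th0; apply: homR_ext => f; rewrite Th0 linear0.
exists ev; apply: bijective_of_inj_surj => [u v Euv|Th].
  apply/eqP; rewrite -subr_eq0; apply/eqP/ev_inj => f.
  by rewrite linearB -!(evE _ (f : dual M)) Euv subrr.
have [w wE] := ev_surj Th; exists w; apply: homR_ext => f.
by rewrite evE wE.
Qed.

(** A functional Th on the dual is determined by y = Th lam, because
    f v * lam = lam v * f for every f in the dual; and y satisfies the
    divisibility condition of [rigid_divisorial]. *)
Lemma reflexive_of_rigid (R : idomainType) (C : lmodType R)
    (lam : {linear C -> R^o}) (v0 : C) :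
  noetherian R -> normal_domain R -> finitely_generated C ->
  injective lam -> v0 != 0 -> Ext_eq0 1 C C -> reflexive_module C.
Proof.
move=> noethR normR fgC lam_inj v0N extC.
have lv0 : (lam v0 : R) != 0.
  by apply: contra_neq v0N => l0; apply: lam_inj; rewrite l0 linear0.
apply: reflexive_of_evaluation => // [u u0|Th].
  by apply: lam_inj; rewrite u0 linear0.
have fswap (f : {linear C -> R^o}) u v : (lam v : R) * f u = lam u * f v.
  by have := congr1 f (embedding_swap u v lam_inj); rewrite !linearZ_LR.
have ThE (f : dual C) v :
    ((f : {linear C -> R^o}) v : R) * Th (lam : dual C) = lam v * Th f.
  have fv : ((f : {linear C -> R^o}) v : R) *: (lam : dual C) =
      (lam v : R) *: f.
    by apply: homR_ext => u; exact: etrans (mulrC _ _) (esym (fswap f u v)).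
  by have := congr1 Th fv; rewrite !linearZ_LR.
have [f v|w wE] := rigid_divisorial (R := R) (y := Th (lam : dual C))
  noethR normR fgC lam_inj v0N extC.
  by exists (Th (f : dual C)); exact: (ThE (f : dual C)).
exists w => f; apply: (mulfI lv0).
by rewrite -ThE -wE mulrC; exact: fswap.
Qed.

Lemma isomorphic_refl (R : comNzRingType) (M : lmodType R) : isomorphic M M.
Proof. by exists (idfun : {linear M -> M}); exists id. Qed.

Lemma isomorphic_inv (R : comNzRingType) (M N : lmodType R) : isomorphic M N ->
  exists (f : {linear M -> N}) (g : {linear N -> M}), cancel f g /\ cancel g f.
Proof.
move=> [f [g fK gK]]; exists f.
pose gL : {linear N -> M} :=
  HB.pack g (GRing.isLinear.Build R N M _ g (can2_linear fK gK)).
by exists gL.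
Qed.

Lemma homothetic_transfer (R : comNzRingType) (M N : lmodType R) :
  isomorphic M N -> homothetic N -> homothetic M.
Proof.
move=> /isomorphic_inv [f [g [fK gK]]] [endo faithful]; split=> [h|a aM].
  have [c cE] := endo (f \o (h \o g) : {linear N -> N}); exists c => u.
  by apply: (can_inj fK); rewrite linearZ_LR -cE /= fK.
by apply: faithful => v; rewrite -(gK v) -linearZ_LR aM linear0.
Qed.

(** A resolution of M becomes one of N by changing its augmentation only. *)
Lemma Ext_eq0_transfer (R : comNzRingType) (M N : lmodType R) i :
  isomorphic M N -> Ext_eq0 i N N -> Ext_eq0 i M M.
Proof.
move=> /isomorphic_inv [f [g [fK gK]]] extN P h hc.
have surj (y : N) : exists x, (f \o pr_aug P : {linear _ -> _}) x = y.
  by have [x xE] := pr_aug_surj P (g y); exists x; rewrite /= xE gK.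
have exact0 y :
    (f \o pr_aug P : {linear _ -> _}) y = 0 <-> exists z, pr_d P 0 z = y.
  by rewrite -pr_exact0 /=; split=> [/(congr1 g)|->]; rewrite ?fK ?linear0.
pose Q := ProjResolution (@pr_projective _ _ P) surj exact0 (@pr_exactS _ _ P).
have : coboundary (P := Q) (f \o h : {linear pr_mod Q i -> N}).
  by apply: extN => y; rewrite /= hc linear0.
case: i extN h hc => [|i] _ h hc /= => [fh0 y|[k kE]].
  by apply: (can_inj fK); rewrite fh0 linear0.
by exists (g \o k : {linear pr_mod P i -> M}) => y; rewrite /= -kE fK.
Qed.

Theorem proposition2p6 (R : idomainType) (noethR : noetherian R)
    (normR : normal_domain R) :
  (forall C : lmodType R, finitely_generated C ->
    (semidualizing_classes 1 (iso_class C) <->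
     has_rank C 1 /\ reflexive_module C /\ Ext_eq0 1 C C)) /\
  (forall X : module_class R, semidualizing_classes 1 X -> Cl X) /\
  (forall I : ideal R, rigid (submodule I) -> reflexive_module (submodule I)).
Proof.
have semidual_to_Cl (C : lmodType R) :
    finitely_generated C -> semidualizing_classes 1 (iso_class C) ->
    has_rank C 1 /\ reflexive_module C /\ Ext_eq0 1 C C.
  move=> fgC [D [_ homD extD] CD].
  have isoCD : isomorphic C D.
    rewrite -[isomorphic C D]/(iso_class C D) CD; exact: isomorphic_refl.
  have homC := homothetic_transfer isoCD ((homothetic_iso D).2 homD).
  have extC : Ext_eq0 1 C C := Ext_eq0_transfer isoCD (extD 1 isT).
  have [v0 v0N] := homothetic_neq0 homC.
  have tfC := homothetic_torsion_free noethR fgC homC.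
  have [lam lam_inj] := homothetic_embedding fgC homC tfC.
  split; first exact: has_rank1_of_embedding lam_inj v0N.
  by split=> //; exact: reflexive_of_rigid lam_inj v0N extC.
split; last split.
- move=> C fgC; split=> [|[rankC [[_ isoC] extC]]]; first exact: semidual_to_Cl.
  have tfC : torsion_free C.
    have [f [g [fK _]]] := isomorphic_inv isoC => a u au.
    have [->|/eqP a0] := eqVneq a 0; [by left | right; apply: (can_inj fK)].
    rewrite linear0; apply: homR_ext => h; apply: (mulfI (introN eqP a0)).
    rewrite mulr0.
    have := congr1 (fun k : dual (dual C) => (k : {linear dual C -> R^o}) h)
      (linearZ_LR f a u).
    by rewrite au linear0.
  have [lam lam_inj] := embedding_of_rank1 fgC tfC rankC.
  have [[e eI] _] := rankC.
  have v0N :=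
    relations_neq0 (p := fun a => a = 0) ord0 eI (elimN eqP (oner_neq0 R)).
  exists C => //; split=> //.
    by apply/homothetic_iso; exact: normal_homothetic lam_inj v0N.
  by move=> [|[|i]].
- move=> X [C semiC ->]; have [fgC _ _] := semiC.
  have [rankC [reflC _]] := semidual_to_Cl C fgC (ex_intro2 _ _ C semiC erefl).
  by exists C.
move=> I rigidI; have fgI := noethR I.
have [[v0 v0N]|I0] := pselect (exists v : submodule I, v != 0).
  exact: (@reflexive_of_rigid R (submodule I) (@submod_val R R^o I) v0
    noethR normR fgI val_inj v0N rigidI).
have {}I0 (v : submodule I) : v = 0.
  by apply: contrapT => /eqP v0; apply: I0; exists v.
apply: reflexive_of_evaluation => // Th; exists 0 => f.
rewrite linear0 (_ : f = 0) ?linear0 //.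
by apply: homR_ext => v; rewrite (I0 v) linear0.
Qed.
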